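(* Let $\mathbf{F}$, $\mathbf{A}$, $\mathbf{W}$ satisfy the standing assumptions listed in the context. Let $\mathbf{X}_0$ be an $\mathbb{R}^d$-valued random variable independent of $\mathbf{W}$, let $\mathbf{X}=(\mathbf{X}_t)_{t\ge 0}$ be the corresponding solution of $\mathrm{d}\mathbf{X}_t=\mathbf{F}(\mathbf{X}_t)\,\mathrm{d}t+\mathbf{A}\,\mathrm{d}\mathbf{W}_t$, and let $X=(X_t)_{t\ge 0}$ be its $d$-th component. Then the distribution of the length $T_{1,\delta}(X)$ of the first monotone run of $(X_{n\delta})_{n\in\mathbb{N}_0}$ converges to the geometric distribution with parameter $1/2$ as $\delta\to 0$, i.e. for all $\ell\in\mathbb{N}\cup\{\infty\}$, $$\lim_{\delta\to 0}P\bigl(T_{1,\delta}(X)=\ell\bigr)=\frac{1}{2^{\ell}},$$ where $1/2^{\infty}:=0$.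
   Context: All random variables live on a common probability space $(\Omega,\mathcal{A},P)$; $\mathbb{N}=\{1,2,\dots\}$, $\mathbb{N}_0=\mathbb{N}\cup\{0\}$. Let $d,m\in\mathbb{N}$ and let $\mathbf{W}=(\mathbf{W}_t)_{t\ge0}$ be an $m$-dimensional standard Brownian motion. Standing assumptions: (i) $\mathbf{F}=(F_1,\dots,F_d):\mathbb{R}^d\to\mathbb{R}^d$ is locally Lipschitz continuous and its $d$-th component $F:=F_d$ has polynomial growth: there are constants $C,p>0$ with $|F(\mathbf{x})|\le C(1+\|\mathbf{x}\|^p)$ for all $\mathbf{x}\in\mathbb{R}^d$. (ii) $\mathbf{A}=(A_{ij})\in\mathbb{R}^{d\times m}$ is such that $A:=(\sum_{j=1}^m A_{dj}^2)^{1/2}>0$. (iii) For every random variable $\mathbf{X}_0:\Omega\to\mathbb{R}^d$ independent of $\mathbf{W}$ there exists a process $\mathbf{X}=(\mathbf{X}_t)_{t\ge0}$ with continuous sample paths such that for every $t\ge 0$, $P$-a.s., $\mathbf{X}_t=\mathbf{X}_0+\int_0^t\mathbf{F}(\mathbf{X}_s)\,\mathrm{d}s+\mathbf{A}\mathbf{W}_t$; this process is called the solution of the SDE with initial condition $\mathbf{X}_0$. For $\delta>0$ and $j\in\mathbb{N}$ put $\Delta X_{j,\delta}:=X_{j\delta}-X_{(j-1)\delta}$. The length of the first monotone run is $T_{1,\delta}(X):=\min\{n\in\mathbb{N}:\Delta X_{n+1,\delta}\,\Delta X_{n,\delta}<0\}$, with $\min\emptyset:=\infty$. *)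

(* Defs.v *)
From HB Require Import structures.
From mathcomp Require Import all_boot all_order all_algebra.
From mathcomp Require Import all_classical all_reals all_analysis.

Set Implicit Arguments.
Unset Strict Implicit.
Unset Printing Implicit Defensive.

Import Order.TTheory GRing.Theory Num.Theory.
Import numFieldNormedType.Exports.

Local Open Scope classical_set_scope.
Local Open Scope ring_scope.

Section probability_notions.
Context (disp : measure_display) (Omega : measurableType disp) (R : realType).
Variable P : probability Omega R.

(* The sigma-algebra generated by the real functions Z i, for i in D. *)
Definition sigma_gen (I : Type) (D : set I) (Z : I -> Omega -> R) :
    set (set Omega) :=
  <<s \bigcup_(i in D) preimage_set_system setT (Z i) measurable >>.

Definition mutually_independent (I : finType) (G : I -> set (set Omega)) :=
  forall (J : {set I}) (E : I -> set Omega), (forall i, i \in J -> G i (E i)) ->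
  P (\bigcap_(i in [set` J]) E i) = (\prod_(i in J) P (E i))%E.

Definition independent2 (G H : set (set Omega)) :=
  forall A B, G A -> H B -> P (A `&` B) = (P A * P B)%E.

Record brownian_motion1 (B : R -> Omega -> R) : Prop := {
  bm_measurable : forall t, 0 <= t -> measurable_fun setT (B t) ;
  bm_start : {ae P, forall w, B 0 w = 0} ;
  bm_continuous :
    {ae P, forall w, {within `[0, +oo[%classic, continuous (B^~ w)}} ;
  bm_independent : forall (n : nat) (t : nat -> R),
    0 <= t 0%N -> (forall i, t i <= t i.+1) ->
    mutually_independent (fun i : 'I_n =>
      sigma_gen [set: unit] (fun _ w => B (t i.+1) w - B (t i) w)) ;
  (* the second parameter of [normal_prob] is the standard deviation *)
  bm_normal : forall s t, 0 <= s -> s < t -> forall S, measurable S ->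
    pushforward P (fun w => B t w - B s w) S =
    normal_prob 0 (Num.sqrt (t - s)) S }.

Definition brownian_motion (m : nat) (W : R -> Omega -> 'cV[R]_m) : Prop :=
  (forall k, brownian_motion1 (fun t w => W t w k 0)) /\
  mutually_independent (fun k : 'I_m =>
    sigma_gen [set t | 0 <= t] (fun t w => W t w k 0)).

(* Componentwise measurability, i.e. Borel measurability into R^n. *)
Definition random_vector (n : nat) (Z : Omega -> 'cV[R]_n) : Prop :=
  forall k, measurable_fun setT (fun w => Z w k 0).

Definition independent_of_process (n m : nat) (Z : Omega -> 'cV[R]_n)
    (W : R -> Omega -> 'cV[R]_m) : Prop :=
  independent2
    (sigma_gen [set: 'I_n] (fun k w => Z w k 0))
    (sigma_gen [set tk : R * 'I_m | 0 <= tk.1]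
       (fun tk w => W tk.1 w tk.2 0)).

(* The noise is additive, so the integral equation is pathwise and involves
   no stochastic integral. *)
Record sde_solution (d m : nat) (F : 'cV[R]_d -> 'cV[R]_d) (A : 'M[R]_(d, m))
    (W : R -> Omega -> 'cV[R]_m) (X0 : Omega -> 'cV[R]_d)
    (X : R -> Omega -> 'cV[R]_d) : Prop := {
  sde_measurable : forall t, 0 <= t -> random_vector (X t) ;
  sde_continuous :
    forall w, {within `[0, +oo[%classic, continuous (X^~ w)} ;
  sde_equation : forall t, 0 <= t -> {ae P, forall w,
    X t w = X0 w
      + \col_i (\int[lebesgue_measure]_(s in `[0, t]) F (X s w) i 0)
      + A *m W t w} }.

End probability_notions.

(* Matrices carry the max norm; in finite dimension neither
   [locally_lipschitz] nor [polynomial_growth] depends on the norm chosen. *)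
Definition locally_lipschitz (R : realType) (n : nat)
    (F : 'cV[R]_n -> 'cV[R]_n) : Prop :=
  forall x : 'cV[R]_n, exists2 U, nbhs x U & [lipschitz F y | y in U].

Definition polynomial_growth (R : realType) (n : nat)
    (f : 'cV[R]_n -> R) : Prop :=
  exists C p : R, [/\ 0 < C, 0 < p &
    forall x, `|f x| <= C * (1 + `|x| `^ p)].

Section monotone_run.
Context (R : realType).

Definition increment (x : R -> R) (delta : R) (j : nat) : R :=
  x (j%:R * delta) - x (j.-1%:R * delta).

Definition turns_at (x : R -> R) (delta : R) (n : nat) : bool :=
  (0 < n)%N && (increment x delta n.+1 * increment x delta n < 0).

(* Values in {1, 2, ...} together with infinity, encoded by [None]. *)
Definition first_run_length (x : R -> R) (delta : R) : option nat :=
  if pselect (exists n, turns_at x delta n) is left turns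
  then Some (ex_minn turns) else None.

Definition half_power (l : option nat) : R :=
  if l is Some n then 1 / 2 ^+ n else 0.

End monotone_run.

(* Main.v *)
Require Import Defs.
From HB Require Import structures.
From mathcomp Require Import all_boot all_order all_algebra.
From mathcomp Require Import all_classical all_reals all_analysis.
Import Order.TTheory GRing.Theory Num.Theory.
From mathcomp Require Import measurable_realfun ring lra.
Import numFieldNormedType.Exports.
Local Open Scope classical_set_scope.
Local Open Scope ring_scope.
Set Implicit Arguments.
Unset Strict Implicit.
Unset Printing Implicit Defensive.

(** Over one step of length delta the increment of the last coordinate of X is
    the integral of the drift over the step plus the increment of the scalar
    noise B, the combination of the components of W with the last row of A as
    coefficients. The drift part is at most M delta as long as X stays in a
    bounded region, whereas the noise part has size of order sqrt delta. For
    small delta the noise therefore decides all the signs that the first run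
    depends on, and those signs are independent fair coin tosses.

    Fair coins. For a finite family of random variables the joint law is fixed
    by its values on boxes ([joint_law_unique]). On boxes the law of the noise
    increments is a product of centred normal laws ([noise_law]), which does
    not change when the increments of one time step all change sign. Hence all
    sign patterns of the increments of B are equally likely, and since these
    increments almost surely do not vanish, each of the 2^n patterns of n
    increments has probability 2^-n ([sign_pattern_law]). A first run of length
    l corresponds to two patterns of l + 1 signs, so for B it has probability
    2 * 2^-(l+1) = 2^-l ([noise_pattern_law]).

    Comparison. By continuity of paths, X stays in the ball of radius K up to
    time 1 with probability close to 1 when K is large ([confined_cvg]). On
    that event M is supplied by the growth condition, and the runs of X and B
    can only differ if some increment of B is at most M delta in absolute value
    ([run_length_noise_pattern]). A normal density of standard deviation
    sqrt delta is bounded by a constant over sqrt delta, so this has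
    probability O(sqrt delta) ([column_small_ball]). Letting delta tend to 0
    and then K to infinity gives the limit for finite l
    ([run_length_Some_cvg]). As the 2^-l add up to 1, no mass is left for an
    infinite run ([run_length_None_cvg]). *)

(** * Finite families of events *)

Section finite_families.
Context d (T : measurableType d) (R : realType) (I : finType).
Variable mu : {measure set T -> \bar R}.
Variable E : I -> set T.
Hypothesis mE : forall i, measurable (E i).

Lemma measurable_finite_forall : measurable [set w | forall i, E i w].
Proof.
rewrite (_ : mkset _ = \bigcap_(i in [set: I]) E i).
  exact: fin_bigcap_measurable.
by apply/seteqP; split => w h // i; exact: h.
Qed.

Let sum_setT (f : I -> \bar R) : (\sum_i f i = \sum_(i \in [set: I]) f i)%E.
Proof.
rewrite fsbig_seq ?index_enum_uniq // (_ : [set` _] = setT) //.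
by apply/seteqP; split => // i _ /=; rewrite mem_index_enum.
Qed.

Lemma measure_finite_exists : trivIset setT E ->
  mu [set w | exists i, E i w] = (\sum_i mu (E i))%E.
Proof.
move=> tE; rewrite sum_setT -measure_fin_bigcup //.
  by congr (mu _); apply/seteqP; split => w [i]; exists i.
exact: finite_finset.
Qed.

Lemma measure_finite_cover (A : set T) : measurable A ->
  (forall w, A w -> exists i, E i w) -> (mu A <= \sum_i mu (E i))%E.
Proof.
move=> mA AE; rewrite sum_setT; apply: content_sub_fsum => //.
  exact: finite_finset.
by move=> w /AE[i Ei]; exists i.
Qed.

End finite_families.

(** * Joint laws of finite families of random variables *)

Section joint_law.
Context (R : realType) (I : finType).

(** The boxes with measurable sides; they generate the product sigma-algebra
    and serve as its pi-system. *)
Definition cylinders : set (set (I -> R)) :=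
  [set C | exists2 S : I -> set R, (forall i, measurable (S i)) &
           C = [set z | forall i, S i (z i)]].

Lemma cylinders_setI : setI_closed cylinders.
Proof.
move=> _ _ [S mS ->] [S' mS' ->]; exists (fun i => S i `&` S' i).
  by move=> i; exact: measurableI.
apply/seteqP; split => z /= => [[h1 h2] i|h]; first by split.
by split=> i; have [] := h i.
Qed.

Lemma measurable_coordinate (i : I) :
  measurable_fun [set: g_sigma_algebraType cylinders]
    (fun z : g_sigma_algebraType cylinders => z i).
Proof.
move=> _ B mB; rewrite setTI; apply: sub_sigma_algebra.
exists (fun j => if j == i then B else setT).
  by move=> j; case: ifP.
apply/seteqP; split => z /= => [zB j|/(_ i)]; last by rewrite eqxx.
by case: eqP => // ->.
Qed.

Lemma measurable_cylinder_preimage d (T : measurableType d) (Z : I -> T -> R)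
    (B : set (I -> R)) :
  (forall i, measurable_fun setT (Z i)) -> <<s cylinders >> B ->
  measurable [set w | B (Z^~ w)].
Proof.
move=> mZ; rewrite -[X in X B]/(@measurable _ (g_sigma_algebraType cylinders)).
have mZ' : @measurable_fun _ _ T (g_sigma_algebraType cylinders)
    setT (fun w => Z^~ w).
  have := @measurability _ _ T (g_sigma_algebraType cylinders) setT
    (fun w => Z^~ w) cylinders; apply => //.
  move=> _ [_ [S mS ->] <-]; rewrite setTI.
  apply: measurable_finite_forall => i.
  by rewrite -[X in measurable X]setTI; exact: mZ.
by move=> mB; rewrite -[X in measurable X]setTI; exact: mZ'.
Qed.

(** Boxes are stable under intersection, and the sets on which the two laws
    agree form a Dynkin class. *)
Lemma joint_law_unique d1 d2 (T1 : measurableType d1) (T2 : measurableType d2)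
    (P1 : probability T1 R) (P2 : probability T2 R)
    (Z1 : I -> T1 -> R) (Z2 : I -> T2 -> R) (B : set (I -> R)) :
  (forall i, measurable_fun setT (Z1 i)) ->
  (forall i, measurable_fun setT (Z2 i)) ->
  (forall S : I -> set R, (forall i, measurable (S i)) ->
     P1 [set w | forall i, S i (Z1 i w)] =
     P2 [set w | forall i, S i (Z2 i w)]) ->
  <<s cylinders >> B ->
  P1 [set w | B (Z1^~ w)] = P2 [set w | B (Z2^~ w)].
Proof.
move=> mZ1 mZ2 P12.
apply: (@dynkin_induction _ (g_sigma_algebraType cylinders) cylinders
  (fun B => P1 [set w | B (Z1^~ w)] = P2 [set w | B (Z2^~ w)])) => //.
- exact: cylinders_setI.
- by rewrite -[LHS]/(P1 setT) -[RHS]/(P2 setT) !probability_setT.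
- by move=> _ [S mS ->]; exact: P12.
- move=> C mC h; rewrite -[LHS]/(P1 (~` [set w | C (Z1^~ w)])).
  rewrite -[RHS]/(P2 (~` [set w | C (Z2^~ w)])) !probability_setC ?h //;
    exact: measurable_cylinder_preimage.
- move=> G mG tG h.
  have key d (T : measurableType d) (P : probability T R) (Z : I -> T -> R) :
    (forall i, measurable_fun setT (Z i)) ->
    P [set w | (\bigcup_k G k) (Z^~ w)] =
    (\sum_(k <oo) P [set w | G k (Z^~ w)])%E.
    move=> mZ; rewrite -measure_semi_bigcup //.
    + by move=> k; apply: measurable_cylinder_preimage => //; exact: mG.
    + apply/trivIsetP => i j _ _ ij.
      move/trivIsetP : tG => /(_ i j Logic.I Logic.I ij) Gij.
      apply/seteqP; split => // w [Gi Gj].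
      by have : (G i `&` G j) (Z^~ w) by []; rewrite Gij.
    + apply: bigcupT_measurable => k.
      by apply: measurable_cylinder_preimage => //; exact: mG.
  by rewrite !key //; apply: eq_eseriesr => k _; exact: h.
Qed.

End joint_law.
Arguments cylinders {R I}.

(** * The centred normal law *)

Section normal_law.
Context (R : realType).
Local Notation mu := (@lebesgue_measure R).

Lemma lebesgue_measure_opp (S : set R) : measurable S ->
  mu (-%R @^-1` S) = mu S.
Proof.
move=> mS.
have mN : measurable_fun [set: R] (-%R : R -> R) by [].
pose nu : {measure set (measurableTypeR R) -> \bar R} :=
  pushforward mu (-%R : measurableTypeR R -> measurableTypeR R).
rewrite -[LHS]/(nu mN S); apply/esym/(@lebesgue_measure_unique R (nu mN)) => //.
move=> X /ocitvP [->|[[a b] ab ->]]; first by rewrite !measure0.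
rewrite -[RHS]/(mu (-%R @^-1` `]a, b]%classic)).
rewrite (_ : -%R @^-1` _ = `[- b, - a[%classic); last first.
  apply/seteqP; split => x /=; rewrite !in_itv /=; lra.
by rewrite !lebesgue_measure_itv /= !lte_fin ltrN2 !EFinN oppeK addeC.
Qed.

Lemma normal_prob_opp (s : R) (S : set R) : s != 0 -> measurable S ->
  normal_prob 0 s (-%R @^-1` S) = normal_prob 0 s S.
Proof.
move=> s0 mS.
have mN : measurable_fun [set: R] (-%R : R -> R) by [].
pose nu : {measure set (measurableTypeR R) -> \bar R} :=
  pushforward mu (-%R : measurableTypeR R -> measurableTypeR R).
transitivity (\int[nu mN]_(x in S) (normal_pdf 0 s x)%:E)%E.
  rewrite (@ge0_integral_pushforward _ _ (measurableTypeR R)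
    (measurableTypeR R) R _ mN mu S) //.
  - apply: eq_integral => x _; congr EFin.
    by rewrite !normal_pdfE // /normal_fun !subr0 sqrrN.
  - apply/measurable_EFinP; apply: measurable_funTS;
    exact: measurable_normal_pdf.
  - by move=> x _; rewrite lee_fin normal_pdf_ge0.
by apply: eq_measure_integral => A mA _; exact: lebesgue_measure_opp.
Qed.

(** The density never exceeds its value at the centre. *)
Lemma normal_prob_itv (s a b : R) : s != 0 -> a <= b ->
  (normal_prob 0%R s `[a, b]%classic <= (normal_peak s * (b - a))%:E)%E.
Proof.
move=> s0 ab; apply: (@le_trans _ _
   (\int[mu]_(x in `[a, b]) (normal_peak s)%:E)%E).
  apply: ge0_le_integral => //.
  - by move=> x _; rewrite lee_fin normal_pdf_ge0.
  - by apply/measurable_EFinP; apply: measurable_funTS;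
    exact: measurable_normal_pdf.
  - by move=> x _; rewrite lee_fin normal_pdf_ub.
rewrite integral_cst // [X in (_ * X)%E](lebesgue_measure_itv `[a, b]) /=.
rewrite lte_fin.
case: ifPn => [_|]; first by rewrite -EFinB -EFinM.
by rewrite -leNgt mule0 lee_fin mulr_ge0 ?normal_peak_ge0 // subr_ge0.
Qed.

End normal_law.

(** * Sums over the columns of a normal grid *)

Section gaussian_grid.
Context (R : realType) d (T : measurableType d) (P : probability T R).
Context (K J : finType) (s : R) (Z : K * J -> T -> R) (a : K -> R).
Hypothesis s0 : s != 0.
Hypothesis mZ : forall i, measurable_fun setT (Z i).
Hypothesis lawZ : forall S : K * J -> set R, (forall i, measurable (S i)) ->
  P [set w | forall i, S i (Z i w)] = (\prod_i normal_prob 0%R s (S i))%E.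

Let normal1 : normal_prob 0 s [set: R] = 1%E.
Proof. exact: (@probability_setT _ _ _ (normal_prob 0 s)). Qed.

Let column (j : J) (w : T) : R := \sum_k a k * Z (k, j) w.

Let measurable_column j : measurable_fun setT (column j).
Proof. by apply: measurable_sum => k; apply: measurable_funM. Qed.

Lemma grid_row_law (j : J) (S : K -> set R) : (forall k, measurable (S k)) ->
  P [set w | forall k, S k (Z (k, j) w)] = (\prod_k normal_prob 0%R s (S k))%E.
Proof.
move=> mS; pose S' (i : K * J) := if i.2 == j then S i.1 else setT.
rewrite (_ : mkset _ = [set w | forall i, S' i (Z i w)]); last first.
  apply/seteqP; split => w /= => [h [k j']|h k].
    by rewrite /S' /=; case: eqP => // ->.
  by have := h (k, j); rewrite /S' /= eqxx.
rewrite lawZ; last by move=> i; rewrite /S'; case: ifP.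
rewrite -(pair_big xpredT xpredT (fun k j => normal_prob 0%R s (S' (k, j)))) /=.
apply: eq_bigr => k _; rewrite (bigD1 j) //= /S' /= eqxx big1 ?mule1 //.
by move=> i /negbTE ->.
Qed.

Lemma grid_entry_law (i : K * J) (S : set R) : measurable S ->
  P (Z i @^-1` S) = normal_prob 0%R s S.
Proof.
move=> mS; pose S' i' := if i' == i then S else setT.
rewrite (_ : _ @^-1` _ = [set w | forall i', S' i' (Z i' w)]); last first.
  apply/seteqP; split => w /= => [ZS i'|/(_ i)]; last by rewrite /S' eqxx.
  by rewrite /S'; case: eqP => // ->.
rewrite lawZ => [|i']; last by rewrite /S'; case: ifP.
rewrite (bigD1 i) //= /S' eqxx big1 ?mule1 // => i' /negbTE.
by move=> ->.
Qed.

(** One summand with a nonzero coefficient already spreads the mass: conditioned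
    on the other summands, the event asks a normal variable to lie in an
    interval of length [2 * (r / `|a k0|)]. The conditioning is made explicit by
    realizing the row on the product [T * T], with [Z (k0, j)] read from the
    second factor and all other entries from the first; by independence this
    leaves the joint law unchanged, and Fubini applies. *)
Lemma column_small_ball (k0 : K) (j : J) (r : R) : a k0 != 0 -> 0 <= r ->
  (P [set w | `|column j w| <= r]%R <=
   (normal_peak s * (2 * (r / `|a k0|)))%:E)%E.
Proof.
move=> ak0 r0.
pose Z1 k := Z (k, j).
pose Z2 k (p : T * T) := if k == k0 then Z1 k p.2 else Z1 k p.1.
have mZ2 k : measurable_fun setT (Z2 k).
  rewrite /Z2; case: (k == k0).
    exact: (measurableT_comp (mZ (k, j)) measurable_snd).
  exact: (measurableT_comp (mZ (k, j)) measurable_fst).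
pose B := [set z : K -> R | `|\sum_k a k * z k| <= r].
have mB : <<s @cylinders R K >> B.
  rewrite -[X in X B]/(@measurable _ (g_sigma_algebraType cylinders)).
  rewrite /B -[X in measurable X]setTI; apply: measurable_fun_ler => //.
  apply: measurableT_comp => //; apply: measurable_sum => k.
  by apply: measurable_funM => //; exact: measurable_coordinate.
rewrite [X in (X <= _)%E](_ : _ = P [set w | B (Z1^~ w)]) //.
rewrite (@joint_law_unique _ _ _ _ _ _ P (P \x P)%E Z1 Z2) //; last 2 first.
- by move=> k; exact: mZ.
- move=> S mS; rewrite grid_row_law //.
  (* The box constraints split into those on the first and on the second
     factor; this is where the product form of the law is used. *)
  pose A := [set w | forall k, (if k == k0 then setT else S k) (Z1 k w)].
  rewrite (_ : [set w | _] = A `*` (Z1 k0 @^-1` S k0)); last first.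
    apply/seteqP; split => -[w1 w2] /= => [h|[h1 h2] k].
      split => [k|]; last by have := h k0; rewrite /Z2 eqxx.
      by have := h k; rewrite /Z2; case: ifP.
    rewrite /Z2; case: eqP => [->//|/eqP kk0].
    by have := h1 k; rewrite (negbTE kk0).
  transitivity (P A * P (Z1 k0 @^-1` S k0))%E; last first.
    apply/esym/product_measure1E.
      apply: measurable_finite_forall => k.
      by rewrite -[X in measurable X]setTI; case: ifP => _; apply: mZ.
    by rewrite -[X in measurable X]setTI; apply: mZ.
  have -> : P A = (\prod_k normal_prob 0 s (if k == k0 then setT else S k))%E.
    apply: (@grid_row_law j (fun k => if k == k0 then setT else S k)) => k.
    by case: ifP.
  rewrite [in LHS](bigD1 k0) //= muleC.
  rewrite [in RHS](bigD1 k0) //= eqxx normal1 mul1e.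
  rewrite (grid_entry_law (k0, j) (mS k0)).
  by congr (_ * _)%E; apply: eq_bigr => k /negbTE ->.
(* Each section at [w1] is an event about [Z (k0, j)] alone. *)
rewrite /product_measure1.
set b := (X in (_ <= X)%E).
have b0 : (0 <= b)%E.
  by rewrite lee_fin mulr_ge0 ?normal_peak_ge0 // mulr_ge0 // divr_ge0.
apply: (@le_trans _ _ (\int[P]_(x in setT) b)%E); last first.
  by rewrite integral_cst // -[X in (_ * X)%E]/(P setT) probability_setT mule1.
have mB' : measurable [set p : T * T | B (Z2^~ p)].
  exact: measurable_cylinder_preimage.
apply: ge0_le_integral => //.
  exact: measurable_fun_xsection.
move=> w1 _ /=; pose c := \sum_(k | k != k0) a k * Z1 k w1.
pose I0 := `[- c / a k0 - r / `|a k0|, - c / a k0 + r / `|a k0|]%classic.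
apply: (@le_trans _ _ (P (Z1 k0 @^-1` I0))).
  apply: le_measure; rewrite ?inE.
  - exact: measurable_xsection.
  - rewrite -[X in measurable X]setTI; apply: mZ => //.
    exact: measurable_itv.
  move=> w2; rewrite /xsection /= inE /= /B /= (bigD1 k0) //= {1}/Z2 eqxx /=.
  under eq_bigr do rewrite /Z2.
  under eq_bigr => k /negbTE kk0 do rewrite kk0.
  rewrite -/c /I0 /= in_itv /= => h.
  rewrite -ler_distl.
  have -> : Z1 k0 w2 - - c / a k0 = (a k0 * Z1 k0 w2 + c) / a k0 by field.
  by rewrite normrM normfV ler_pM2r // invr_gt0 normr_gt0.
rewrite (grid_entry_law (k0, j)); last exact: measurable_itv.
apply: (le_trans (@normal_prob_itv _ _ _ _ _ _)) => //.
  have : 0 <= r / `|a k0| by rewrite divr_ge0.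
  lra.
rewrite /b lee_fin ler_wpM2l ?normal_peak_ge0 //.
rewrite le_eqVlt; apply/orP; left; apply/eqP; ring.
Qed.

Lemma prob_column_eq0 (j : J) : (exists k, a k != 0) ->
  P [set w | column j w = 0] = 0%E.
Proof.
move=> [k0 ak0]; apply/eqP; rewrite eq_le measure_ge0 andbT.
have := @column_small_ball k0 j 0 ak0 (lexx 0).
rewrite mul0r !mulr0; congr (P _ <= _)%E.
by apply/seteqP; split => w /=; rewrite normr_le0 => /eqP.
Qed.

(** Flipping the sign of the columns selected by [e] preserves the joint law, so
    all [2 ^ #|J|] patterns have the same probability; they exhaust the whole
    space up to the null event that some column sum vanishes. *)
Lemma sign_pattern_law (e : J -> bool) : (exists k, a k != 0) ->
  P [set w | forall j, 0 < (-1) ^+ e j * column j w] = (2 ^- #|J|)%:E.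
Proof.
move=> aN0.
pose pos := [set w | forall j, 0 < column j w].
pose pat (e : J -> bool) := [set w | forall j, 0 < (-1) ^+ e j * column j w].
have mpat e' : measurable (pat e').
  apply: measurable_finite_forall => j.
  rewrite -[X in measurable X]setTI; apply: measurable_fun_ltr => //.
  by apply: measurable_funM.
have patE e' : P (pat e') = P pos.
  pose Z' (i : K * J) w := (-1) ^+ e' i.2 * Z i w.
  pose B := [set z : K * J -> R | forall j, 0 < \sum_k a k * z (k, j)].
  have mB : <<s cylinders >> B.
    rewrite -[X in X B]/(@measurable _ (g_sigma_algebraType cylinders)).
    apply: measurable_finite_forall => j.
    rewrite -[X in measurable X]setTI; apply: measurable_fun_ltr => //.
    apply: measurable_sum => k.
    by apply: measurable_funM => //; exact: measurable_coordinate.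
  transitivity (P [set w | B (Z'^~ w)]).
    congr (P _); apply/seteqP; split => w /= h j; have := h j;
      rewrite /column mulr_sumr /Z' /=;
      by under eq_bigr do rewrite mulrCA.
  rewrite (@joint_law_unique _ _ _ _ _ _ P P Z' Z) // => [i|S mS].
    by apply: measurable_funM.
  rewrite lawZ //.
  (* The flip is moved from the variables to the sides of the box, where the
     symmetry of the normal law absorbs it. *)
  pose S' (i : K * J) := if e' i.2 then -%R @^-1` S i else S i.
  have mS' i : measurable (S' i).
    rewrite /S'; case: ifP => // _; rewrite -[X in measurable X]setTI.
    exact: (@measurable_funN _ _ _ _ id).
  transitivity (\prod_i normal_prob 0%R s (S' i))%E.
    rewrite -lawZ //; congr (P _); apply/seteqP.
    split => w /= h i; have := h i; rewrite /S' /Z'; case: (e' i.2) => /=;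
      by rewrite ?expr0 ?expr1 ?mul1r ?mulN1r.
  apply: eq_bigr => i _; rewrite /S'; case: ifP => // _.
  exact: normal_prob_opp.
have total : (\sum_(f : {ffun J -> bool}) P (pat f) = 1)%E.
  rewrite -measure_finite_exists //; last first.
    apply/trivIsetP => f g _ _ fg; apply/seteqP; split => // w [/= hf hg].
    case/eqP: fg; apply/ffunP => j; have := hf j; have := hg j.
    by case: (f j); case: (g j) => //; rewrite ?expr1 ?expr0; lra.
  have mU : measurable [set w | exists f : {ffun J -> bool}, pat f w].
    rewrite (_ : mkset _ = \bigcup_(f in [set: {ffun J -> bool}]) pat f).
      by apply: fin_bigcup_measurable => // f _; exact: mpat.
    by apply/seteqP; split => w [f]; exists f.
  rewrite -[LHS]/(P _); apply/eqP; rewrite eq_le probability_le1 //=.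
  rewrite -[X in (_ <= P X)%E]setCK probability_setC; last exact: measurableC.
  have m0 j : measurable [set w | column j w = 0].
    rewrite -[X in measurable X]setTI.
    exact: (measurable_column j) measurableT _ (measurable_set1 0).
  rewrite (_ : P (~` _) = 0%E) ?sube0 //; apply/eqP.
  rewrite eq_le measure_ge0 andbT.
  apply: (@le_trans _ _ (\sum_j P [set w | column j w = 0%R])%E).
    apply: measure_finite_cover => //; first exact: measurableC.
    move=> w /= h; apply: contrapT => c0; apply: h.
    exists [ffun j => column j w < 0] => j; rewrite ffunE.
    have : column j w <> 0 by move=> cj0; apply: c0; exists j.
    case: (ltgtP (column j w) 0) => // c _ /=.
      by rewrite expr1 mulN1r oppr_gt0.
    by rewrite expr0 mul1r.
  by rewrite big1 // => j _; exact: prob_column_eq0.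
have [p pE] : exists p : R, P pos = p%:E.
  by exists (fine (P pos)); rewrite fineK // -(patE e) fin_num_measure.
move: total; under eq_bigr do rewrite patE pE.
rewrite sumEFin sumr_const card_ffun card_bool => -[].
rewrite -[p *+ _]mulr_natr natrX => pX.
rewrite -[LHS]/(P (pat e)) patE pE; congr EFin.
by rewrite -[p](mulfK (_ : 2 ^+ #|J| != 0)) ?expf_neq0 // pX mul1r.
Qed.

End gaussian_grid.

(** * Increments of Brownian motion on a regular time grid *)

Section brownian_grid.
Context (R : realType) d (T : measurableType d) (P : probability T R).

Lemma sigma_gen_measurable (I : Type) (D : set I) (Z : I -> T -> R) (i : I) :
  D i -> @measurable_fun _ _
    (g_sigma_algebraType
      (\bigcup_(i in D) preimage_set_system setT (Z i) measurable))
    R setT (Z i).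
Proof.
move=> Di _ B mB; rewrite setTI; apply: sub_sigma_algebra.
by exists i => //; exists B => //; rewrite setTI.
Qed.

Context (m : nat) (W : R -> T -> 'cV[R]_m) (n : nat) (delta : R).
Hypothesis W_bm : brownian_motion P W.
Hypothesis delta0 : 0 < delta.

Definition noise (i : 'I_m * 'I_n) (w : T) : R :=
  W (i.2.+1%:R * delta) w i.1 0 - W (i.2%:R * delta) w i.1 0.

Lemma measurable_noise i : measurable_fun setT (noise i).
Proof.
have [/(_ i.1) W1 _] := W_bm.
by apply: measurable_funB; apply: (bm_measurable W1); rewrite mulr_ge0 // ltW.
Qed.

(** Independence of the components of [W] factors the event over [k], since the
    events of component [k] belong to the sigma-algebra of that component;
    independence of increments then factors each component over [j]. *)
Lemma noise_law (S : 'I_m * 'I_n -> set R) : (forall i, measurable (S i)) ->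
  P [set w | forall i, S i (noise i w)] =
  (\prod_i normal_prob 0%R (Num.sqrt delta) (S i))%E.
Proof.
move=> mS; have [W1 Windep] := W_bm.
pose E k := [set w | forall j, S (k, j) (noise (k, j) w)].
transitivity (P (\bigcap_(k in [set` [set: 'I_m]%SET]) E k)).
  congr (P _); apply/seteqP; split => w h; first by move=> k _ j; exact: h.
  by move=> [k j]; apply: (h k); rewrite /= inE.
rewrite Windep; last first.
  move=> k _; rewrite /sigma_gen.
  set C := (X in <<s X >>).
  have mW t : 0 <= t -> @measurable_fun _ _ (g_sigma_algebraType C) R setT
      (fun w => W t w k 0).
    exact: (@sigma_gen_measurable _ [set t | 0 <= t] (fun t w => W t w k 0)).
  apply: (@measurable_finite_forall _ (g_sigma_algebraType C)) => j.
  rewrite -[X in measurable X]setTI.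
  have : @measurable_fun _ _ (g_sigma_algebraType C) R setT (noise (k, j)).
    by apply: measurable_funB; apply: mW; rewrite mulr_ge0 // ltW.
  by apply.
transitivity (\prod_k \prod_j normal_prob 0%R (Num.sqrt delta) (S (k, j)))%E;
  last by rewrite pair_bigA; apply: eq_bigr => -[].
apply: eq_big => [k|k _]; first by rewrite inE.
pose t (i : nat) := i%:R * delta.
have t0 : 0 <= t 0%N by rewrite /t mul0r.
have tS i : t i <= t i.+1 by rewrite ler_pM2r // ler_nat.
have Pk := @bm_independent _ _ _ _ _ (W1 k) n t t0 tS.
transitivity (P (\bigcap_(j in [set` [set: 'I_n]%SET])
    (noise (k, j) @^-1` S (k, j)))).
  congr (P _); apply/seteqP; split => w h; first by move=> j _; exact: h.
  by move=> j; apply: (h j); rewrite /= inE.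
rewrite Pk => [|j _]; last first.
  apply: sub_sigma_algebra; exists tt => //.
  by exists (S (k, j)) => //; rewrite setTI.
apply: eq_big => [j|j _]; first by rewrite inE.
have := bm_normal (W1 k) (_ : 0 <= t j) (_ : t j < t j.+1) (mS (k, j)).
rewrite (_ : t j.+1 - t j = delta); last by rewrite /t -natr1; ring.
apply; first by rewrite mulr_ge0 // ltW.
by rewrite ltr_pM2r // ltr_nat.
Qed.

End brownian_grid.

(** * The first monotone run *)

Section first_run.
Context (R : realType).

Lemma first_run_length_SomeP (x : R -> R) (delta : R) (l : nat) :
  first_run_length x delta = Some l <->
  turns_at x delta l /\ (forall i, turns_at x delta i -> (l <= i)%N).
Proof.
rewrite /first_run_length; case: pselect => [ex|nex]; last first.
  by split => // -[tl _]; case: nex; exists l.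
case: ex_minnP => n tn minn; split => [[<-] //|[tl minl]].
by congr Some; apply/eqP; rewrite eqn_leq minn // minl.
Qed.

(** The first turn is at [l] exactly when the first [l] increments share a sign,
    recorded by [b], and the next one has the opposite sign. *)
Lemma first_run_length_signs (x : R -> R) (delta : R) (l : nat) : (0 < l)%N ->
  (forall j, (j <= l)%N -> increment x delta j.+1 != 0) ->
  first_run_length x delta = Some l <->
  exists b : bool, forall j : 'I_l.+1,
    0 < (-1) ^+ (b (+) (j == l :> nat)) * increment x delta j.+1.
Proof.
move=> l0 neq0; rewrite first_run_length_SomeP; set y := increment x delta.
split=> [[tl minl]|[b yb]].
- have same j : (j < l)%N -> 0 < (-1) ^+ (y 1%N < 0)%R * y j.+1.
    elim: j => [_|j ih jl].
      case: (ltgtP (y 1%N) 0) (neq0 0%N isT) => //= h _.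
        by rewrite expr1 mulN1r oppr_gt0.
      by rewrite expr0 mul1r.
    have := ih (ltnW jl) => {}ih.
    have : ~~ turns_at x delta j.+1.
      by apply/negP => /minl; rewrite leqNgt jl.
    rewrite /turns_at /= -/y -leNgt => yy.
    rewrite lt_neqAle eq_sym mulf_neq0 ?signr_eq0 ?neq0 1?ltnW //=.
    by rewrite -(pmulr_lge0 _ ih) mulrACA -expr2 sqrr_sign mul1r.
  exists (y 1%N < 0) => j; case: (eqVneq (j : nat) l) => [jl|jl]; last first.
    by rewrite addbF same // ltn_neqAle jl -ltnS ltn_ord.
  rewrite addbT jl; move: tl; rewrite /turns_at l0 /= -/y => tl.
  have := same l.-1; rewrite prednK // leqnn => /(_ isT) s.
  rewrite signrN mulNr oppr_gt0 -(pmulr_llt0 _ s) mulrACA -expr2 sqrr_sign.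
  by rewrite mul1r.
- have yl : 0 < (-1) ^+ (~~ b) * y l.+1.
    by have := yb ord_max; rewrite /= eqxx addbT.
  have ylt j : (j < l)%N -> 0 < (-1) ^+ b * y j.+1.
    move=> jl; have := yb (Ordinal (leqW jl)).
    by rewrite /= (ltn_eqF jl) addbF.
  split.
    rewrite /turns_at l0 /= -/y.
    have := ylt l.-1; rewrite prednK // leqnn => /(_ isT) s.
    move: yl; rewrite signrN mulNr oppr_gt0 -(pmulr_llt0 _ s) mulrACA -expr2.
    by rewrite sqrr_sign mul1r.
  move=> i; rewrite /turns_at -/y => /andP[i0 yy].
  rewrite leqNgt; apply/negP => il.
  have s1 := ylt i il; have := ylt i.-1; rewrite prednK // => /(_ (ltnW il)) s2.
  move: yy; rewrite ltNge => /negP; apply; apply: ltW.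
  by have := mulr_gt0 s1 s2; rewrite mulrACA -expr2 sqrr_sign mul1r.
Qed.

End first_run.

(** * Bounds along a continuous path *)

Section drift.
Context (R : realType) (n : nat).
Implicit Types x : R -> 'cV[R]_n.+1.

Lemma mx_norm_leP (v : 'cV[R]_n.+1) (K : R) : 0 <= K ->
  `|v| <= K <-> forall i, `|v i 0| <= K.
Proof.
move=> K0; rewrite [`|v|]mx_normrE; split => [/bigmax_leP[_ h] i|h].
  exact: (h (i, 0)).
by apply/bigmax_leP; split => // -[i j] _ /=; rewrite ord1.
Qed.

(** Countably many times suffice to control the path, which makes confinement
    to a ball a measurable event. The half-open interval leaves room for a
    rational time to the right of [s]. *)
Lemma norm_le_of_rationals x (K : R) :
  {within `[0, +oo[%classic, continuous x} ->
  (forall q : rat, 0 <= (ratr q : R) < 1 -> `|x (ratr q)| <= K) ->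
  forall s, 0 <= s < 1 -> `|x s| <= K.
Proof.
move=> cx xq s /andP[s0 s1]; rewrite leNgt; apply/negP => Ks.
have As : `[0, +oo[%classic s by rewrite /= in_itv /= s0.
have xs : `|x u| @[u --> within `[0, +oo[%classic (nbhs s)] --> `|x s|.
  by apply: cvg_norm; have := cx s; rewrite /continuous_at nbhs_subspace_in.
have /= : \forall u \near within `[0, +oo[%classic (nbhs s), K < `|x u|.
  by apply: cvgr_gt Ks.
rewrite near_withinE => -[e /= e0 ball_e].
have [q] : exists q, (ratr q : R) \in `]s, (Num.min (s + e) 1)[.
  by apply: rat_in_itvoo; rewrite lt_min s1 ltrDl e0.
rewrite in_itv /= lt_min => /and3P[sq qe q1].
have q0 : 0 <= (ratr q : R) by rewrite (le_trans s0) // ltW.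
have := xq q; rewrite q0 q1 => /(_ isT); rewrite leNgt => /negP; apply.
apply: ball_e; last by rewrite /= in_itv /= q0.
by rewrite /= distrC ger0_norm ?subr_ge0 ?(ltW sq) // ltrBlDl.
Qed.

Lemma drift_increment_le (f : 'cV[R]_n.+1 -> R) x (M a b : R) :
  continuous f -> {within `[0, +oo[%classic, continuous x} ->
  (forall s, 0 <= s < 1 -> `|f (x s)| <= M) ->
  0 <= a -> a <= b -> b < 1 ->
  `|\int[lebesgue_measure]_(s in `[0, b]) f (x s) -
    \int[lebesgue_measure]_(s in `[0, a]) f (x s)| <= M * (b - a).
Proof.
move=> cf cx fM a0 ab b1.
have fint : lebesgue_measure.-integrable `[0, b]%classic (EFin \o (f \o x)).
  apply: continuous_compact_integrable; first exact: segment_compact.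
  have cx' : {within `[0, b]%classic, continuous x}.
    apply: continuous_subspaceW cx => s /=; rewrite !in_itv /=.
    by case/andP => ->.
  move=> s; apply: (@continuous_comp (subspace `[0, b]%classic) _ _ x f s).
    exact: (cx' s).
  exact: cf.
have fint' : lebesgue_measure.-integrable `]a, b]%classic (EFin \o (f \o x)).
  apply: integrableS fint => //; apply: subset_itvScc => //.
rewrite (Rintegral_itvB fint) ?bnd_simp //.
apply: le_trans (le_normr_Rintegral _ fint') _ => //.
apply: (@le_trans _ _ (\int[lebesgue_measure]_(s in `]a, b]) M)).
  apply: le_Rintegral => //.
  - by have := integrable_norm fint'.
  - apply: measurable_bounded_integrable => //.
    + rewrite [X in (X < _)%E](lebesgue_measure_itv `]a, b]) /=.
      by case: ifP => _; rewrite ?ltry.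
    + exists `|M|; split; first exact: num_real.
      by move=> y /= My s _ /=; exact: ltW.
  - by move=> s /=; rewrite in_itv /= => /andP[as_ sb]; apply: fM;
      rewrite (le_trans a0 (ltW as_)) (le_lt_trans sb).
rewrite Rintegral_cst // [X in fine X](lebesgue_measure_itv `]a, b]) /= lte_fin.
move: ab; rewrite le_eqVlt => /predU1P[->|->]; last by rewrite lexx.
by rewrite ltxx subrr.
Qed.

End drift.

(** * Comparison of the solution with its noise *)

Lemma locally_lipschitz_continuous (R : realType) (n : nat)
    (F : 'cV[R]_n.+1 -> 'cV[R]_n.+1) : locally_lipschitz F -> continuous F.
Proof.
move=> Flip x; have [U Ux] := Flip x.
move=> /pinfty_ex_gt0[M M0 lipM].
apply/(@cvgrPdist_lt _ 'cV[R]_n.+1 _ (nbhs x)) => e e0.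
have xr : \forall y \near x, `|x - y| < e / M.
  by apply: (@cvgr_dist_lt _ 'cV[R]_n.+1 _ (nbhs x) _ id x cvg_id);
    exact: divr_gt0.
near=> y.
have Uy : U y by near: y.
apply: (le_lt_trans (lipM (x, y) _)) => /=.
  by split => //; exact: nbhs_singleton.
by rewrite mulrC -ltr_pdivlMr //; near: y.
Unshelve. all: by end_near.
Qed.

Section coupling.
Context (disp : measure_display) (Omega : measurableType disp).
Context (R : realType) (P : probability Omega R) (d m : nat).
Context (F : 'cV[R]_d.+1 -> 'cV[R]_d.+1) (A : 'M[R]_(d.+1, m.+1)).
Context (W : R -> Omega -> 'cV[R]_m.+1).
Context (X0 : Omega -> 'cV[R]_d.+1) (X : R -> Omega -> 'cV[R]_d.+1).
Hypothesis W_bm : brownian_motion P W.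
Hypothesis F_cont : continuous F.
Hypothesis F_growth : polynomial_growth (fun x => F x ord_max 0).
Hypothesis A_neq0 : exists k, A ord_max k != 0.
Hypothesis X_sol : sde_solution P F A W X0 X.

Let Xd (w : Omega) (t : R) : R := X t w ord_max 0.

Lemma measurable_turns_at (delta : R) (i : nat) : 0 < delta ->
  measurable [set w | turns_at (Xd w) delta i].
Proof.
move=> delta0.
have mX t : 0 <= t -> measurable_fun setT (fun w => Xd w t).
  by move=> t0; exact: (sde_measurable X_sol t0).
have mI j : measurable_fun setT (fun w => increment (Xd w) delta j).
  by apply: measurable_funB; apply: mX; rewrite mulr_ge0 // ltW.
rewrite /turns_at; case: (0 < i)%N => /=; last first.
  by rewrite (_ : mkset _ = set0) //; apply/seteqP; split.
rewrite -[X in measurable X]setTI; apply: measurable_fun_ltr => //.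
exact: measurable_funM.
Qed.

Lemma measurable_first_run_length (delta : R) (l : option nat) : 0 < delta ->
  measurable [set w | first_run_length (Xd w) delta = l].
Proof.
move=> delta0; case: l => [l|].
  rewrite (_ : mkset _ = [set w | turns_at (Xd w) delta l] `&`
      [set w | forall i : 'I_l, ~ turns_at (Xd w) delta i]); last first.
    apply/seteqP; split => w /=; rewrite first_run_length_SomeP => -[tl h].
      split=> // i ti; have := h _ ti; rewrite leqNgt; apply/negP/negPn.
      exact: ltn_ord.
    split=> // i ti; rewrite leqNgt; apply/negP => il.
    exact: (h (Ordinal il)).
  apply: measurableI; first exact: measurable_turns_at.
  apply: measurable_finite_forall => i.
  by apply: measurableC; exact: measurable_turns_at.
rewrite (_ : mkset _ = ~` \bigcup_i [set w | turns_at (Xd w) delta i]).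
  apply: measurableC; apply: bigcupT_measurable => i.
  exact: measurable_turns_at.
apply/seteqP; split => w /=; rewrite /first_run_length; case: pselect => //.
  by move=> nex _ [i _ ti]; apply: nex; exists i.
by move=> [i ti] []; exists i.
Qed.

(** Confinement is tested at rational times only, so that it is an event. *)
Definition confined (K : nat) : set Omega :=
  [set w | forall q : rat, 0 <= (ratr q : R) < 1 -> `|X (ratr q) w| <= K%:R].

Lemma measurable_confined K : measurable (confined K).
Proof.
rewrite (_ : confined K = ~` \bigcup_(q in [set: rat]) [set w |
    0 <= (ratr q : R) < 1 /\ ~ (`|X (ratr q) w| <= K%:R)]); last first.
  apply/seteqP; split => w /= h; first by move=> [q _ [/h q01]].
  move=> q q01; apply: contrapT => nle; apply: h; exists q => //.
apply: measurableC; apply: countable_bigcupT_measurable => // q.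
have [q01|nq01] := boolP (0 <= (ratr q : R) < 1); last first.
  by rewrite (_ : mkset _ = set0) //; apply/seteqP; split => // w [].
rewrite (_ : mkset _ = ~` [set w | forall i, `|X (ratr q) w i 0| <= K%:R]).
  apply: measurableC; apply: measurable_finite_forall => i.
  rewrite -[X in measurable X]setTI; apply: measurable_fun_ler => //.
  apply: measurableT_comp => //.
  by case/andP: q01 => q0 _; exact: (sde_measurable X_sol q0 i).
apply/seteqP; split => w /=.
  by move=> [_ h] /mx_norm_leP h'; apply: h; exact: h'.
by move=> h; split=> // /mx_norm_leP h'; apply: h; exact: h'.
Qed.

(** Every path is bounded on the compact interval [0, 1]. *)
Lemma confined_cvg : P (~` confined K) @[K --> \oo] --> 0%E.
Proof.
rewrite -(measure0 P) (_ : set0 = \bigcap_K ~` confined K).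
  apply: (nonincreasing_cvg_mu (F := fun K => ~` confined K)).
  - by rewrite (le_lt_trans (probability_le1 _ _)) ?ltry //;
      exact/measurableC/measurable_confined.
  - by move=> K; exact/measurableC/measurable_confined.
  - apply: bigcapT_measurable => K; exact/measurableC/measurable_confined.
  - move=> K L KL; apply/subsetPset/subsetC => w h q /h /le_trans; apply.
    by rewrite ler_nat.
rewrite -setC_bigcup; apply/esym; rewrite -setCT; congr (~` _).
apply/seteqP; split => // w _.
have cX : {within `[0, 1]%classic, continuous (fun t => `|X t w|)}.
  move=> s; apply: cvg_norm; move: s.
  have cw : {within `[0, +oo[%classic, continuous (X^~ w)}.
    exact: (sde_continuous X_sol).
  have sub : (`[0, 1]%classic : set R) `<=` `[0, +oo[%classic.
    by move=> t /=; rewrite !in_itv /= => /andP[->].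
  exact: (continuous_subspaceW sub cw).
have [c _ hc] := EVT_max ler01 cX.
exists (Num.bound `|X c w|) => // q /andP[q0 q1].
apply: (le_trans (hc _ _)); first by rewrite in_itv /= q0 ltW.
exact/ltW/archi_boundP.
Qed.


Let column delta n (j : 'I_n) (w : Omega) : R :=
  \sum_k A ord_max k * noise W delta (k, j) w.

Lemma measurable_column delta n (j : 'I_n) : 0 < delta ->
  measurable_fun setT (column delta j).
Proof.
move=> delta0; apply: measurable_sum => k; apply: measurable_funM => //.
exact: (measurable_noise W_bm delta0).
Qed.

Lemma drift_bounded (K : nat) : exists2 M, 0 <= M &
  forall v : 'cV[R]_d.+1, `|v| <= K%:R -> `|F v ord_max 0| <= M.
Proof.
have [C [p [C0 p0 FC]]] := F_growth.
exists (C * (1 + K%:R `^ p)).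
  by rewrite mulr_ge0 ?ltW // addr_gt0 // ltr_wpDr ?powR_ge0.
move=> v vK; apply: (le_trans (FC v)); rewrite ler_pM2l // lerD2l.
by rewrite ge0_ler_powR // ?nnegrE // ltW.
Qed.

(** The event that the first run of the noise has length [l], up to the null
    event that some increment vanishes. *)
Definition noise_pattern (delta : R) (l : nat) : set Omega :=
  [set w | exists b : bool, forall j : 'I_l.+1,
    0 < (-1) ^+ (b (+) (j == l :> nat)) * column delta j w].

Lemma sqrt_neq0 (delta : R) : 0 < delta -> Num.sqrt delta != 0.
Proof. by move=> delta0; rewrite gt_eqF // sqrtr_gt0. Qed.

Lemma noise_pattern_law (delta : R) (l : nat) : 0 < delta ->
  measurable (noise_pattern delta l) /\
  P (noise_pattern delta l) = (half_power R (Some l))%:E.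
Proof.
move=> delta0.
pose E (b : bool) := [set w | forall j : 'I_l.+1,
    0 < (-1) ^+ (b (+) (j == l :> nat)) * column delta j w].
have mE b : measurable (E b).
  apply: measurable_finite_forall => j.
  rewrite -[X in measurable X]setTI; apply: measurable_fun_ltr => //.
  by apply: measurable_funM => //; exact: measurable_column.
have lawE b : P (E b) = (2 ^- l.+1)%:E.
  have := @sign_pattern_law R _ _ P _ _ (Num.sqrt delta) (noise W delta)
    (A ord_max) (sqrt_neq0 delta0) (measurable_noise W_bm delta0)
    (noise_law W_bm delta0) (fun j : 'I_l.+1 => b (+) (j == l :> nat)) A_neq0.
  by rewrite card_ord.
split.
  rewrite (_ : noise_pattern _ _ = E true `|` E false).
    exact: measurableU.
  apply/seteqP; split => w; first by move=> [[] h]; [left|right].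
  by case=> h; [exists true|exists false].
rewrite -[LHS]/(P [set w | exists b, E b w]) measure_finite_exists //.
  rewrite (eq_bigr (fun=> (2 ^- l.+1)%:E)) => [|b _]; last exact: lawE.
  rewrite big_bool /= -EFinD; congr EFin.
  rewrite div1r exprS invfM.
  by field; rewrite expf_neq0.
apply/trivIsetP => b c _ _ bc; apply/seteqP; split => // w [/= hb hc].
have := hb ord_max; have := hc ord_max.
case: b c bc {hb hc} => -[] // _; rewrite /= eqxx /= ?expr1 ?expr0; lra.
Qed.

Let drift delta (j : nat) (w : Omega) : R :=
  \int[lebesgue_measure]_(s in `[0, j.+1%:R * delta]) F (X s w) ord_max 0 -
  \int[lebesgue_measure]_(s in `[0, j%:R * delta]) F (X s w) ord_max 0.

Lemma increment_decomposition (delta : R) (n : nat) : 0 < delta ->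
  {ae P, forall w, forall j : 'I_n,
    increment (Xd w) delta j.+1 = drift delta j w + column delta j w}.
Proof.
move=> delta0.
have tick (j : nat) : 0 <= j%:R * delta by rewrite mulr_ge0 // ltW.
have : {ae P, forall w, forall j : nat, X (j%:R * delta) w = X0 w
    + \col_i (\int[lebesgue_measure]_(s in `[0, j%:R * delta]) F (X s w) i 0)
    + A *m W (j%:R * delta) w}.
  by apply: ae_foralln => j; exact: (sde_equation X_sol (tick j)).
apply: filterS => w eqX j.
rewrite /increment /Xd !eqX /= !mxE /drift /column /noise /=.
under [X in _ = _ + X]eq_bigr do rewrite mulrBr.
rewrite sumrB; ring.
Qed.

(** A drift contribution of smaller absolute value than the noise increment
    cannot change its sign. *)
Lemma run_length_noise_pattern (delta M : R) (K l : nat) (w : Omega) :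
  0 < delta -> (0 < l)%N -> l.+1%:R * delta < 1 ->
  (forall v : 'cV[R]_d.+1, `|v| <= K%:R -> `|F v ord_max 0| <= M) ->
  confined K w ->
  (forall j : 'I_l.+1,
    increment (Xd w) delta j.+1 = drift delta j w + column delta j w) ->
  (forall j : 'I_l.+1, M * delta < `|column delta j w|) ->
  first_run_length (Xd w) delta = Some l <-> noise_pattern delta l w.
Proof.
move=> delta0 l0 ldelta FM wK dec large.
have cw : {within `[0, +oo[%classic, continuous (X^~ w)}.
  exact: (sde_continuous X_sol).
have small (j : 'I_l.+1) : `|drift delta j w| <= M * delta.
  rewrite (_ : M * delta = M * (j.+1%:R * delta - j%:R * delta)); last first.
    by rewrite -natr1; ring.
  apply: (@drift_increment_le _ _ (fun v => F v ord_max 0)) => //.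
  - move=> v; apply: (@continuous_comp _ _ _ F (fun u => u ord_max 0)).
      exact: F_cont.
    exact: coord_continuous.
  - by move=> s s01; apply: FM; exact: (norm_le_of_rationals cw wK).
  - by rewrite mulr_ge0 // ltW.
  - by rewrite ler_pM2r // ler_nat.
  - by rewrite (le_lt_trans _ ldelta) // ler_pM2r // ler_nat ltn_ord.
have signE (e : bool) (j : 'I_l.+1) :
    (0 < (-1) ^+ e * increment (Xd w) delta j.+1) =
    (0 < (-1) ^+ e * column delta j w).
  have := large j; have := small j; rewrite dec.
  rewrite ler_norml ltr_normr => /andP[h1 h2] /orP h3.
  by case: e; rewrite /= ?expr1 ?expr0 ?mulN1r ?mul1r; apply/idP/idP => h4;
    case: h3; lra.
rewrite first_run_length_signs //.
  by split=> -[b h]; exists b => j; [rewrite -signE|rewrite signE]; exact: h.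
move=> j jl; pose i := @Ordinal l.+1 j jl.
have := large i; have := small i; rewrite (dec i).
rewrite ler_norml ltr_normr => /andP[h1 h2] h3.
by apply/eqP => h4; case/orP: h3; lra.
Qed.

(** The error collects the two ways in which the noise can fail to decide the
    run: leaving the ball of radius [K], and a noise increment dominated by the
    drift. The latter costs a density of order [1 / Num.sqrt delta] times an
    interval of length of order [delta]. *)
Lemma run_length_coupling (K l : nat) : (0 < l)%N ->
  exists2 c : R, 0 <= c & forall delta, 0 < delta -> l.+1%:R * delta < 1 ->
  let p := P [set w | first_run_length (Xd w) delta = Some l] in
  let q := (half_power R (Some l))%:E in
  let e := (P (~` confined K) + (c * Num.sqrt delta)%:E)%E in
  (p <= q + e /\ q <= p + e)%E.
Proof.
move=> l0; have [M M0 FM] := drift_bounded K; have [k0 ak0] := A_neq0.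
pose c1 := (Num.sqrt (pi *+ 2))^-1 * (2 * (M / `|A ord_max k0|)).
exists (l.+1%:R * c1).
  by rewrite mulr_ge0 // mulr_ge0 ?invr_ge0 ?sqrtr_ge0 // mulr_ge0 // divr_ge0.
move=> delta delta0 ldelta p q e.
have [mpat lawpat] := noise_pattern_law l delta0.
pose small (j : 'I_l.+1) := [set w | `|column delta j w| <= M * delta].
have msmall j : measurable (small j).
  rewrite -[X in measurable X]setTI; apply: measurable_fun_ler => //.
  by apply: measurableT_comp => //; exact: measurable_column.
have msome : measurable [set w | exists j, small j w].
  rewrite (_ : mkset _ = \bigcup_(j in setT) small j).
    by apply: fin_bigcup_measurable => //; exact: finite_finset.
  by apply/seteqP; split => w [j]; exists j.
have Psmall : (P [set w | exists j, small j w] <=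
    (l.+1%:R * c1 * Num.sqrt delta)%:E)%E.
  apply: (le_trans (measure_finite_cover P msmall msome _)) => //.
  apply: (@le_trans _ _ (\sum_(j < l.+1) (c1 * Num.sqrt delta)%:E)%E).
    apply: lee_sum => j _.
    have r0 : 0 <= M * delta by rewrite mulr_ge0 // ltW.
    have := @column_small_ball R _ _ P _ _ (Num.sqrt delta) (noise W delta)
      (A ord_max) (sqrt_neq0 delta0) (measurable_noise W_bm delta0)
      (noise_law W_bm delta0) k0 j _ ak0 r0.
    move=> /le_trans; apply; rewrite lee_fin le_eqVlt; apply/orP; left.
    apply/eqP.
    rewrite /normal_peak sqr_sqrtr ?ltW // -mulrnAr sqrtrM ?ltW // invfM /c1.
    have sd : M * delta = M * Num.sqrt delta * Num.sqrt delta.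
      by rewrite -mulrA -expr2 sqr_sqrtr // ltW.
    rewrite sd; field.
    by rewrite normr_eq0 ak0 !sqrt_neq0 // mulrn_wgt0 // pi_gt0.
  by rewrite sumEFin sumr_const card_ord -[X in (X%:E <= _)%E]mulr_natl mulrA.
have [N [mN N0 decN]] := increment_decomposition l.+1 delta0.
pose bad := ~` confined K `|` [set w | exists j, small j w] `|` N.
have mbad : measurable bad.
  apply: measurableU => //; apply: measurableU => //.
  exact/measurableC/measurable_confined.
have Pbad : (P bad <= e)%E.
  apply: (le_trans (measureU2 _ _ _)) => //.
    by apply: measurableU => //; exact/measurableC/measurable_confined.
  rewrite [X in (_ + X)%E]N0 adde0; apply: (le_trans (measureU2 _ _ _)) => //.
    exact/measurableC/measurable_confined.
  by rewrite leeD2l.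
have mrun := measurable_first_run_length (Some l) delta0.
have agree w : ~ bad w ->
    first_run_length (Xd w) delta = Some l <-> noise_pattern delta l w.
  move=> /not_orP[/not_orP[/contrapT wK big] nN].
  apply: (run_length_noise_pattern delta0 l0 ldelta FM wK).
    by apply: contrapT => nd; apply: nN; exact: decN.
  move=> j; rewrite ltNge; apply/negP => sj; apply: big; by exists j.
have cover (B C : set Omega) : measurable B -> measurable C ->
    (forall w, ~ bad w -> B w -> C w) -> (P B <= P C + e)%E.
  move=> mB mC BC; apply: (@le_trans _ _ (P (C `|` bad))).
    apply: le_measure; rewrite ?inE //; first exact: measurableU.
    by move=> w Bw; have [|nb] := pselect (bad w); [right|left; exact: BC].
  by apply: (le_trans (measureU2 _ _ _)) => //; rewrite leeD2l.
rewrite /q -lawpat; split; apply: cover => // w nb.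
  by move=> /(agree w nb).
by move=> /(agree w nb).
Qed.


Lemma run_length_Some_cvg (l : nat) : (0 < l)%N ->
  P [set w | first_run_length (Xd w) delta = Some l]
    @[delta --> 0^'+] --> (half_power R (Some l))%:E.
Proof.
move=> l0.
have fin (delta : R) : 0 < delta ->
    P [set w | first_run_length (Xd w) delta = Some l] \is a fin_num.
  by move=> delta0; rewrite fin_num_measure //;
    exact: measurable_first_run_length.
apply/fine_cvgP; split.
  by near=> delta; apply: fin; near: delta; exact: nbhs_right_gt.
apply/cvgrPdist_le => eps eps0.
(* [K] has to be fixed before [delta], because the constant [c] below
   depends on it. *)
have [K confK] : exists K, (P (~` confined K) <= (eps / 2)%:E)%E.
  have /fine_cvgP[_ /cvgrPdist_le/(_ (eps / 2) _)[|K _ cK]] := confined_cvg.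
    exact: divr_gt0.
  exists K; have := cK K (leqnn K); rewrite /= sub0r normrN.
  rewrite ger0_norm ?fine_ge0 // -lee_fin fineK // fin_num_measure //.
  exact/measurableC/measurable_confined.
have [c c0 bound] := run_length_coupling K l0.
pose eta := eps / 2 / (c + 1).
have eta0 : 0 < eta by rewrite divr_gt0 ?divr_gt0 // ltr_wpDl.
near=> delta.
have delta0 : 0 < delta by near: delta; exact: nbhs_right_gt.
have ldelta : l.+1%:R * delta < 1.
  by rewrite mulrC -ltr_pdivlMr // mul1r; near: delta; apply: nbhs_right_lt;
    rewrite invr_gt0.
have cdelta : c * Num.sqrt delta <= eps / 2.
  have sdelta : Num.sqrt delta <= eta.
    rewrite -[eta]ger0_norm ?(ltW eta0) // -sqrtr_sqr ler_wsqrtr // ltW //.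
    by near: delta; apply: nbhs_right_lt; exact: exprn_gt0.
  apply: (@le_trans _ _ ((c + 1) * eta)).
    by rewrite ler_pM ?sqrtr_ge0 // lerDl.
  by rewrite /eta mulrC divfK // gt_eqF // ltr_wpDl.
have [] := bound delta delta0 ldelta; rewrite /= -(fineK (fin _ delta0)).
set p := fine _; set q : R := 1 / 2 ^+ l.
have err : (P (~` confined K) + (c * Num.sqrt delta)%:E <= eps%:E)%E.
  by rewrite (splitr eps) EFinD leeD // lee_fin.
move=> /le_trans/(_ (leeD2l _ err)) h1 /le_trans/(_ (leeD2l _ err)) h2.
move: h1 h2; rewrite -!EFinD !lee_fin => h1 h2.
by rewrite /= -/p -/q ler_distl; apply/andP; split; lra.
Unshelve. all: by end_near.
Qed.

(** The run lengths 1, ..., L carry mass [1 - 2 ^- L] in the limit, which bounds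
    the mass of an infinite run by [2 ^- L] for every [L]. *)
Lemma run_length_None_cvg :
  P [set w | first_run_length (Xd w) delta = None] @[delta --> 0^'+] --> 0%E.
Proof.
pose E (delta : R) (l : option nat) :=
  [set w | first_run_length (Xd w) delta = l].
have fin (delta : R) l : 0 < delta -> P (E delta l) \is a fin_num.
  by move=> delta0; rewrite fin_num_measure //;
    exact: measurable_first_run_length.
apply/fine_cvgP; split.
  by near=> delta; apply: fin; near: delta; exact: nbhs_right_gt.
apply/cvgrPdist_le => eps eps0.
have [L Leps] : exists L, (2 ^- L : R) <= eps / 2.
  have h1 : `|2^-1 : R| < 1 by rewrite ger0_norm //; lra.
  have /cvgrPdist_le/(_ (eps / 2) _)[|L _ hL] := cvg_expr h1.
    exact: divr_gt0.
  exists L; have := hL L (leqnn L); rewrite sub0r normrN exprVn.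
  by rewrite ger0_norm // invr_ge0 exprn_ge0.
have sum_cvg n : \sum_(i < n) fine (P (E delta (Some i.+1)))
    @[delta --> 0^'+] --> (1 - 2 ^- n : R).
  elim: n => [|n ih].
    under eq_fun do rewrite big_ord0.
    by rewrite expr0 invr1 subrr; exact: cvg_cst.
  under eq_fun do rewrite big_ord_recr.
  rewrite (_ : 1 - 2 ^- n.+1 = 1 - 2 ^- n + half_power R (Some n.+1)).
    apply: cvgD; first exact: ih.
    by have /fine_cvgP[] := run_length_Some_cvg (ltn0Sn n).
  rewrite /= div1r exprS invfM.
  by field; rewrite expf_neq0.
have near_sum : \forall delta \near 0^'+,
    `|1 - 2 ^- L - \sum_(i < L) fine (P (E delta (Some i.+1)))| <= eps / 2.
  by move/cvgrPdist_le : (sum_cvg L); apply; exact: divr_gt0.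
near=> delta.
have delta0 : 0 < delta by near: delta; exact: nbhs_right_gt.
have close : `|1 - 2 ^- L - \sum_(i < L) fine (P (E delta (Some i.+1)))|
    <= eps / 2.
  by near: delta; exact: near_sum.
have mE l : measurable (E delta l) by exact: measurable_first_run_length.
pose U := [set w | exists i : 'I_L, E delta (Some i.+1) w].
have mU : measurable U.
  rewrite (_ : U = \bigcup_(i in setT) E delta (Some (i : 'I_L).+1)).
    by apply: fin_bigcup_measurable => //; exact: finite_finset.
  by apply/seteqP; split => w [i]; exists i.
have PU : P U = (\sum_(i < L) fine (P (E delta (Some i.+1))))%:E.
  rewrite /U
    (measure_finite_exists P (E := fun i : 'I_L => E delta (Some i.+1))) //.
    by rewrite -sumEFin; apply: eq_bigr => i _; rewrite fineK // fin.
  apply/trivIsetP => i j _ _ ij; apply/seteqP; split => // w [].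
  rewrite /E /= => -> [ji].
  by case/eqP: ij; apply/val_inj.
have : (P (E delta None) + P U <= 1)%E.
  have disj : E delta None `&` U = set0.
    apply/seteqP; split => // w [eN [i]].
    by rewrite /E /= in eN *; rewrite eN.
  have <- : P (E delta None `|` U) = (P (E delta None) + P U)%E.
    exact: measureU.
  by apply: probability_le1; exact: measurableU.
rewrite PU -(fineK (fin delta None delta0)) -EFinD lee_fin => total.
move: close; rewrite ler_distl => /andP[h1 h2].
rewrite /= sub0r normrN ger0_norm ?fine_ge0 //.
by rewrite -[fine _]/(fine (P (E delta None))); lra.
Unshelve. all: by end_near.
Qed.

End coupling.

Theorem theorem2p2 (disp : measure_display) (Omega : measurableType disp)
    (R : realType) (P : probability Omega R) (d m : nat)
    (F : 'cV[R]_d.+1 -> 'cV[R]_d.+1) (A : 'M[R]_(d.+1, m.+1))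
    (W : R -> Omega -> 'cV[R]_m.+1)
    (W_bm : brownian_motion P W)
    (F_lipschitz : locally_lipschitz F)
    (F_growth : polynomial_growth (fun x => F x ord_max 0))
    (A_gt0 : 0 < Num.sqrt (\sum_(j < m.+1) A ord_max j ^+ 2))
    (solvable : forall X0 : Omega -> 'cV[R]_d.+1,
       random_vector X0 -> independent_of_process P X0 W ->
       exists X, sde_solution P F A W X0 X)
    (X0 : Omega -> 'cV[R]_d.+1)
    (X0_measurable : random_vector X0)
    (X0_independent : independent_of_process P X0 W)
    (X : R -> Omega -> 'cV[R]_d.+1)
    (X_solution : sde_solution P F A W X0 X) :
  forall l : option nat, l <> Some 0%N ->
  P [set w | first_run_length (fun t => X t w ord_max 0) delta = l]
    @[delta --> 0^'+] --> (half_power R l)%:E.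
Proof.
have F_cont := locally_lipschitz_continuous F_lipschitz.
have A_neq0 : exists k, A ord_max k != 0.
  apply: contrapT => /forallNP A0; move: A_gt0.
  rewrite big1 ?sqrtr0 ?ltxx // => j _.
  by have /negP := A0 j; rewrite negbK => /eqP ->; rewrite expr0n.
case=> [[|l]|] // _.
  exact: (run_length_Some_cvg W_bm F_cont F_growth A_neq0 X_solution).
exact: (run_length_None_cvg W_bm F_cont F_growth A_neq0 X_solution).
Qed.
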